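(* Let $n \ge 3$, let $T \subset \mathbb{R}^2$ be a convex, non-degenerate $n$-gon with vertices $\mathbf{x}_1,\dots,\mathbf{x}_n$, and let $K_T \subset \mathbb{R}^2$ be the reference polygon associated with $T$, i.e. $$K_T = U_T\begin{bmatrix} \mathbf{v}_{1,T}^t \\ \mathbf{v}_{2,T}^t \end{bmatrix}(S_{n-1}),$$ where $S_{n-1}$ is the standard simplex in $\mathbb{R}^n$ and $U_T, \mathbf{v}_{1,T}, \mathbf{v}_{2,T}$ come from a singular value decomposition of the centered vertex matrix $B_T$ of $T$ (as defined in the context). Then the in-radius of $K_T$ is greater than or equal to $\sqrt{\frac{1}{n(n-1)}}$, and the outer-radius of $K_T$ is less than or equal to $\sqrt{\frac{n-1}{n}}$. Consequently, the ratio $\rho$ between the outer-radius and the in-radius of $K_T$ satisfies $$1 \le \rho \le n-1 .$$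
   Context: An $n$-gon is a (closed) polygon in $\mathbb{R}^2$ with $n$ vertices. A polygon is non-degenerate if no three of its vertices lie on the same line. For a polygon, its in-radius is the maximum radius of all disks contained inside it, and its outer-radius is the minimum radius of all disks containing it. The simplex $S_{n-1}$ is $$S_{n-1} = \Big\{ [\lambda_1,\dots,\lambda_n]^t \in \mathbb{R}^n \;\Big|\; \sum_{i=1}^n \lambda_i = 1,\ \lambda_i \ge 0 \text{ for } 1\le i\le n\Big\}.$$ For an $n$-gon $T$ with vertices $\mathbf{x}_1,\dots,\mathbf{x}_n\in\mathbb{R}^2$ (column vectors), let $\mathbf{x}_T = \frac1n\sum_{i=1}^n \mathbf{x}_i$ be its arithmetic center and let $$B_T = [\mathbf{x}_1-\mathbf{x}_T,\ \mathbf{x}_2-\mathbf{x}_T,\ \cdots,\ \mathbf{x}_n-\mathbf{x}_T] \in \mathbb{R}^{2\times n}.$$ Let $B_T = U_T \Sigma_T V_T^t$ be a singular value decomposition, where $U_T\in\mathbb{R}^{2\times 2}$ and $V_T = [\mathbf{v}_{1,T}\ \mathbf{v}_{2,T}\ \cdots\ \mathbf{v}_{n,T}]\in\mathbb{R}^{n\times n}$ are orthogonal matrices, and $$\Sigma_T = \begin{bmatrix}\sigma_{1,T}& 0 & 0 & \cdots & 0 \\ 0 & \sigma_{2,T} & 0 & \cdots & 0\end{bmatrix}\in\mathbb{R}^{2\times n},\qquad \sigma_{1,T}\ge\sigma_{2,T},$$ with both singular values positive when $T$ is non-degenerate. Set $P_T = U_T\begin{bmatrix} \mathbf{v}_{1,T}^t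 \\ \mathbf{v}_{2,T}^t \end{bmatrix}\in\mathbb{R}^{2\times n}$, so that $B_T = \big(U_T\,\mathrm{diag}(\sigma_{1,T},\sigma_{2,T})\,U_T^t\big)P_T$. The set $K_T = P_T(S_{n-1}) = \{P_T\boldsymbol{\lambda} : \boldsymbol{\lambda}\in S_{n-1}\}$ is an $n$-gon in $\mathbb{R}^2$. *)

(* Defs.v *)
From mathcomp Require Import all_boot all_order all_algebra.
From mathcomp Require Import all_classical all_reals.

Set Implicit Arguments.
Unset Strict Implicit.
Unset Printing Implicit Defensive.

Import Order.TTheory GRing.Theory Num.Theory.

Local Open Scope classical_set_scope.
Local Open Scope ring_scope.

Section Planar.
Variable R : realType.
Implicit Types (T K : set 'cV[R]_2) (r : R).

Definition simplex n : set 'cV[R]_n :=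
  [set l | \sum_i l i 0 = 1 /\ forall i, 0 <= l i 0].
Arguments simplex : clear implicits.

Definition extreme_point T (p : 'cV[R]_2) : Prop :=
  T p /\ forall y z t, T y -> T z -> 0 < t < 1 ->
    p = (1 - t) *: y + t *: z -> y = z.

(* A convex polygon is the convex hull of its vertices, and its vertices are
   its extreme points. The indexing of the vertices need not follow the
   boundary. *)
Definition convex_ngon n T (x : 'I_n -> 'cV[R]_2) : Prop :=
  [/\ T = [set \sum_i l i 0 *: x i | l in simplex n],
      injective x
    & forall i, extreme_point T (x i)].

Definition line (a d : 'cV[R]_2) : set 'cV[R]_2 := [set a + t *: d | t in setT].

Definition non_degenerate n (x : 'I_n -> 'cV[R]_2) : Prop :=
  forall i j k, i != j -> j != k -> i != k ->
    ~ exists a d, [/\ d != 0, line a d (x i), line a d (x j) & line a d (x k)].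

(* The Euclidean norm: the library norm on matrices is the max norm. *)
Definition enorm (v : 'cV[R]_2) : R := Num.sqrt (\sum_i v i 0 ^+ 2).

Definition disk (c : 'cV[R]_2) r : set 'cV[R]_2 := [set y | enorm (y - c) <= r].

Definition is_inradius K r : Prop :=
  let radii := [set r' | 0 <= r' /\ exists c, disk c r' `<=` K] in
  radii r /\ ubound radii r.

Definition is_outradius K r : Prop :=
  let radii := [set r' | 0 <= r' /\ exists c, K `<=` disk c r'] in
  radii r /\ lbound radii r.

Definition arith_center n (x : 'I_n -> 'cV[R]_2) : 'cV[R]_2 :=
  n%:R^-1 *: \sum_i x i.

Definition centered_mx n (x : 'I_n -> 'cV[R]_2) : 'M[R]_(2, n) :=
  \matrix_(i, j) (x j - arith_center x) i 0.

Definition orthogonal_mx n (A : 'M[R]_n) : Prop :=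
  A^T *m A = 1%:M /\ A *m A^T = 1%:M.

Definition sigma_mx n (s1 s2 : R) : 'M[R]_(2, n) :=
  \matrix_(i, j) (if i == j :> nat then if i == 0 then s1 else s2 else 0).

Definition is_svd n (B : 'M[R]_(2, n)) (U : 'M[R]_2) (s1 s2 : R)
    (V : 'M[R]_n) : Prop :=
  [/\ orthogonal_mx U, orthogonal_mx V, 0 <= s2 <= s1
    & B = U *m sigma_mx n s1 s2 *m V^T].

(* U [v_1 v_2]^t, the v_i being the columns of V. *)
Definition ref_mx n (hn : (2 <= n)%N) (U : 'M[R]_2) (V : 'M[R]_n) :
    'M[R]_(2, n) :=
  U *m (colsub (widen_ord hn) V)^T.

Definition ref_polygon n (hn : (2 <= n)%N) (U : 'M[R]_2) (V : 'M[R]_n) :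
    set 'cV[R]_2 :=
  [set ref_mx hn U V *m l | l in simplex n].

End Planar.

Arguments simplex {R} n _.

(* Main.v *)
(* Non-degeneracy forces both singular values to be positive, so P := P_T has
   orthonormal rows and its columns p_i sum to 0: P^T P + J/n, with J the all-ones
   matrix, is an orthogonal projection. Bessel's inequality
   |P l|^2 + (sum l_i)^2/n <= |l|^2 puts the image of the simplex in the disk of
   squared radius 1 - 1/n about 0. Conversely y is the image of P^T y + 1/n, whose
   coordinates p_i . y + 1/n sum to 1 and are nonnegative when
   |y|^2 <= 1/(n(n-1)), since |p_i|^2 <= 1 - 1/n. The in-radius and the
   outer-radius are attained by compactness. *)
Require Import Defs.
From mathcomp Require Import all_boot all_order all_algebra.
From mathcomp Require Import all_classical all_reals.
From mathcomp Require Import topology normedtype derive realfun.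
From mathcomp Require Import ring lra.

Set Implicit Arguments.
Unset Strict Implicit.
Unset Printing Implicit Defensive.

Import Order.TTheory GRing.Theory Num.Theory.
Import numFieldNormedType.Exports.

Local Open Scope classical_set_scope.
Local Open Scope ring_scope.

Lemma sum_continuous (R : realType) (T : topologicalType) (V : normedModType R)
    n (F : 'I_n -> T -> V) :
  (forall i, continuous (F i)) -> continuous (fun x => \sum_i F i x).
Proof.
by move=> cF; apply: continuous_big => // i; exact: add_continuous.
Qed.

Section Enorm.
Variable R : realType.
Implicit Types (u v c : 'cV[R]_2) (r : R).

Lemma sqr_enorm v : enorm v ^+ 2 = \sum_i v i 0 ^+ 2.
Proof. by rewrite /enorm sqr_sqrtr// sumr_ge0// => i _; rewrite sqr_ge0. Qed.

Lemma enorm_ge0 v : 0 <= enorm v.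
Proof. exact: sqrtr_ge0. Qed.

Lemma enorm_le v r : 0 <= r -> (enorm v <= r) = (\sum_i v i 0 ^+ 2 <= r ^+ 2).
Proof. by move=> r0; rewrite -sqr_enorm ler_sqr ?nnegrE ?enorm_ge0. Qed.

Lemma enorm0 : enorm (0 : 'cV[R]_2) = 0.
Proof. by rewrite /enorm big1 ?sqrtr0// => i _; rewrite mxE expr0n. Qed.

Lemma enormZ a v : enorm (a *: v) = `|a| * enorm v.
Proof.
rewrite /enorm (eq_bigr (fun i => a ^+ 2 * v i 0 ^+ 2)); last first.
  by move=> i _; rewrite mxE exprMn.
by rewrite -mulr_sumr sqrtrM ?sqr_ge0// sqrtr_sqr.
Qed.

Lemma coord_le_enorm v i : `|v i 0| <= enorm v.
Proof.
rewrite -ler_sqr ?nnegrE ?normr_ge0 ?enorm_ge0// sqr_enorm real_normK ?num_real//.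
by rewrite (bigD1 i)//= lerDl sumr_ge0// => j _; rewrite sqr_ge0.
Qed.

Lemma enorm_continuous : continuous (@enorm R).
Proof.
move=> v; apply: (@continuous_comp _ _ _ (fun v : 'cV[R]_2 => \sum_i v i 0 ^+ 2));
  last exact: sqrt_continuous.
apply: sum_continuous => i w.
apply: (@continuous_comp _ _ _ (fun v : 'cV[R]_2 => v i 0) (fun a => a ^+ 2)).
  exact: coord_continuous.
exact: exprn_continuous.
Qed.

Lemma disk_center c r : 0 <= r -> disk c r c.
Proof. by move=> r0; rewrite /disk/= subrr enorm0. Qed.

Lemma disk_unitE c r : 0 <= r -> disk c r = [set c + r *: u | u in disk 0 1].
Proof.
move=> r0; apply/seteqP; split => [y|y [u]]; rewrite /disk/= ?subr0.
- move=> yr; move: r0; rewrite le_eqVlt => /orP[/eqP r0|r0].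
    exists 0; first by rewrite subr0 enorm0 ler01.
    rewrite scaler0 addr0; apply/colP => i; apply/eqP.
    rewrite eq_sym -subr_eq0 -normr_le0 r0; apply: le_trans yr.
    by have := coord_le_enorm (y - c) i; rewrite !mxE.
  exists (r^-1 *: (y - c)); last by rewrite scalerA divff ?gt_eqF// scale1r subrKC.
  by rewrite subr0 enormZ gtr0_norm ?invr_gt0// mulrC ler_pdivrMr// mul1r.
- move=> u1 <-; rewrite addrAC subrr add0r enormZ ger0_norm//.
  by rewrite -[leRHS]mulr1 ler_wpM2l.
Qed.

Lemma disk_extremes c r : 0 <= r ->
  disk c r (c + r *: delta_mx 0 0) /\ disk c r (c - r *: delta_mx 0 0).
Proof.
move=> r0; have e1 : enorm (delta_mx 0 0 : 'cV[R]_2) = 1.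
  rewrite /enorm big_ord_recl big_ord1 !mxE/= expr1n expr0n addr0.
  by rewrite sqrtr1.
rewrite /disk/= ![c + _ - c]addrAC subrr !add0r -scaleNr !enormZ normrN e1 mulr1.
by rewrite ger0_norm.
Qed.

Lemma disk_subset_le c c' r r' : 0 <= r -> disk c r `<=` disk c' r' -> r <= r'.
Proof.
move=> r0 sub; have [/sub + /sub] := disk_extremes c r0.
move=> /(le_trans (coord_le_enorm _ 0)) + /(le_trans (coord_le_enorm _ 0)).
rewrite !mxE/= !ler_norml => /andP[? ?] /andP[? ?]; lra.
Qed.

End Enorm.

Section Compactness.
Variable R : realType.

Lemma mulmx_cV_continuous m n (P : 'M[R]_(m.+1, n.+1)) :
  continuous (fun v : 'cV[R]_n.+1 => P *m v).
Proof.
rewrite (_ : mulmx P = fun v : 'cV[R]_n.+1 => \sum_j v j 0 *: col j P).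
  apply: sum_continuous => j v.
  exact: cvgZr_tmp (@coord_continuous _ _ _ j 0 v).
apply/funext => v; apply/colP => i; rewrite !mxE summxE.
by apply: eq_bigr => j _; rewrite !mxE mulrC.
Qed.

Lemma trmx_rV_continuous n : continuous (fun v : 'rV[R]_n.+1 => v^T).
Proof.
rewrite (_ : @trmx R 1 n.+1 =
  fun v : 'rV[R]_n.+1 => \sum_j v 0 j *: (delta_mx j 0 : 'cV[R]_n.+1)).
  apply: sum_continuous => j v.
  exact: cvgZr_tmp (@coord_continuous _ _ _ 0 j v).
apply/funext => v; rewrite {1}[v]row_sum_delta linear_sum.
by apply: eq_bigr => j _; rewrite linearZ/= trmx_delta.
Qed.

Lemma cV_box_compact n (a b : R) :
  compact [set v : 'cV[R]_n.+1 | forall i, a <= v i 0 <= b].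
Proof.
rewrite (_ : [set _ | _] = trmx @`
    [set v : 'rV[R]_n.+1 | forall i, `[a, b]%classic (v ord0 i)]).
  apply: continuous_compact.
    by apply: continuous_subspaceT => ?; exact: trmx_rV_continuous.
  by apply: (@rV_compact _ _ (fun=> `[a, b]%classic)) => _; exact: segment_compact.
apply/seteqP; split => [v vab|_ [v vab <-]] /=.
  exists v^T; last by rewrite trmxK.
  by move=> i; rewrite /= mxE in_itv/= vab.
by move=> i; have := vab i; rewrite /= in_itv/= mxE.
Qed.

Lemma simplex_compact n : compact (simplex n.+1 : set 'cV[R]_n.+1).
Proof.
apply: (subclosed_compact _ (@cV_box_compact n 0 1)).
  rewrite (_ : simplex _ = [set l : 'cV[R]_n.+1 | \sum_i l i 0 = 1] `&`
     \bigcap_(i in setT) [set l : 'cV[R]_n.+1 | 0 <= l i 0]).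
    apply: closedI.
      apply: (@preimage_closed _ _ (fun l : 'cV[R]_n.+1 => \sum_i l i 0)
        [set a | a = 1]); last exact: closed_eq.
      by move=> x _; apply: sum_continuous => i; exact: coord_continuous.
    apply: closed_bigI => i _.
    apply: (@preimage_closed _ _ (fun l : 'cV[R]_n.+1 => l i 0)
      [set a | 0 <= a]); last exact: closed_ge.
    by move=> x _; exact: coord_continuous.
  apply/seteqP; split=> [l [? l0]|l [? l0]]; split=> // i; last exact: l0.
  by move=> _; exact: l0.
by move=> l [l1 l0] i /=; rewrite l0/= -l1 (bigD1 i)//= lerDl sumr_ge0.
Qed.

Lemma image_simplex_compact m n (P : 'M[R]_(m.+1, n)) : (0 < n)%N ->
  compact [set P *m l | l in simplex n].
Proof.
case: n P => // n P _; apply: continuous_compact; last exact: simplex_compact.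
by apply: continuous_subspaceT => ?; exact: mulmx_cV_continuous.
Qed.

Lemma ex_inradius (K : set 'cV[R]_2) M :
  compact K -> K !=set0 -> K `<=` disk 0 M -> exists r, is_inradius K r.
Proof.
move=> Kc [p Kp] KM.
pose G := [set q : 'cV[R]_2 * R | 0 <= q.2 /\ disk q.1 q.2 `<=` K].
have Gc : compact G.
  apply: (@subclosed_compact _ _ (K `*` `[0, M + M]%classic)); last 2 first.
  - by apply: compact_setX => //; exact: segment_compact.
  - move=> [c r] [/= r0 sub]; split => /=; first exact: sub (disk_center c r0).
    rewrite in_itv/= r0/=.
    have := KM _ (sub _ (disk_center c r0)).
    have [/sub/KM + _] := disk_extremes c r0.
    move=> /(le_trans (coord_le_enorm _ 0)) + /(le_trans (coord_le_enorm _ 0)).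
    rewrite !mxE/= !ler_norml => /andP[? ?] /andP[? ?]; lra.
  rewrite (_ : G = [set q | 0 <= q.2] `&`
      \bigcap_(u in disk 0 1) [set q | K (q.1 + q.2 *: u)]).
    apply: closedI.
      apply: (@preimage_closed _ _ snd [set x : R | 0 <= x]); last exact: closed_ge.
      by move=> x _; exact: cvg_snd.
    apply: closed_bigI => u _.
    apply: (@preimage_closed _ _ (fun q : 'cV[R]_2 * R => q.1 + q.2 *: u) K).
      move=> x _; apply: cvgD; first exact: cvg_fst.
      by apply: cvgZr_tmp; exact: cvg_snd.
    by apply: compact_closed => //; exact: norm_hausdorff.
  apply/seteqP; split=> [[c r] [/= r0]|[c r] [/= r0]].
    by rewrite disk_unitE// => sub; split=> // u u1; apply: sub; exists u.
  by move=> sub; split=> //=; rewrite disk_unitE// => _ [u u1 <-]; exact: sub.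
have [] := @compact_EVT_max _ R snd G _ Gc.
- exists (p, 0); split=> //=; rewrite disk_unitE// => _ [u _ <-].
  by rewrite scale0r addr0.
- by apply: continuous_subspaceT => x; exact: cvg_snd.
move=> [c r]; rewrite inE => -[/= r0 sub] rmax; exists r; split.
  by split=> //; exists c.
by move=> r' [r'0 [c' sub']]; apply: (rmax (c', r')); rewrite inE.
Qed.

Lemma ex_outradius (K : set 'cV[R]_2) M :
  K !=set0 -> K `<=` disk 0 M -> exists r, is_outradius K r.
Proof.
move=> [p Kp] KM.
have M0 : 0 <= M by apply: le_trans (KM _ Kp); exact: enorm_ge0.
pose G := [set q : 'cV[R]_2 * R | 0 <= q.2 <= M /\ K `<=` disk q.1 q.2].
have Gc : compact G.
  apply: (@subclosed_compact _ _
    ([set c : 'cV[R]_2 | forall i, - (M + M) <= c i 0 <= M + M] `*`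
     `[0, M]%classic)); last 2 first.
  - apply: compact_setX; [exact: cV_box_compact|exact: segment_compact].
  - move=> [c r] [/= /andP[r0 rM] sub]; split => /=;
      last by rewrite in_itv/= r0 rM.
    move=> i; have := le_trans (coord_le_enorm _ i) (sub _ Kp).
    have := le_trans (coord_le_enorm _ i) (KM _ Kp).
    rewrite !mxE !ler_norml => /andP[? ?] /andP[? ?]; apply/andP; split; lra.
  rewrite (_ : G = [set q | 0 <= q.2] `&` [set q | q.2 <= M] `&`
      \bigcap_(y in K) [set q | 0 <= q.2 - enorm (y - q.1)]).
    apply: closedI; first apply: closedI.
    - apply: (@preimage_closed _ _ snd [set x : R | 0 <= x]); last exact: closed_ge.
      by move=> x _; exact: cvg_snd.
    - apply: (@preimage_closed _ _ snd [set x : R | x <= M]); last exact: closed_le.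
      by move=> x _; exact: cvg_snd.
    apply: closed_bigI => y _.
    apply: (@preimage_closed _ _
      (fun q : 'cV[R]_2 * R => q.2 - enorm (y - q.1)) [set a | 0 <= a]);
      last exact: closed_ge.
    move=> x _; apply: cvgB; first exact: cvg_snd.
    apply: (@continuous_comp _ _ _ (fun q : 'cV[R]_2 * R => y - q.1)
      (@enorm R)); last exact: enorm_continuous.
    by apply: cvgB; [exact: cvg_cst|exact: cvg_fst].
  apply/seteqP; split=> [[c r] [/= /andP[r0 rM] sub]|[c r] [[/= r0 rM] sub]].
    by do !split=> //; move=> y /sub; rewrite /disk/= subr_ge0.
  by split=> /=; [rewrite r0 rM|move=> y /sub; rewrite /disk/= subr_ge0].
have GM : G (0, M) by split=> //=; rewrite M0 lexx.
have [] := @compact_EVT_min _ R snd G _ Gc.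
- by exists (0, M).
- by apply: continuous_subspaceT => x; exact: cvg_snd.
move=> [c r]; rewrite inE => -[/= /andP[r0 rM] sub] rmin; exists r; split.
  by split=> //; exists c.
move=> r' [r'0 [c' sub']].
have [r'M|/ltW Mr'] := leP r' M; last exact: le_trans Mr'.
by apply: (rmin (c', r')); rewrite inE; split=> //=; rewrite r'0.
Qed.

End Compactness.

Section Frame.
Variables (R : realType) (n : nat) (P : 'M[R]_(2, n)).
Hypothesis n_gt1 : (1 < n)%N.
Hypothesis PPt : P *m P^T = 1%:M.
Hypothesis P1 : P *m const_mx 1 = 0 :> 'cV_2.

Let n_gt0 : 0 < n%:R :> R.
Proof. by rewrite ltr0n ltnW. Qed.

Let n1_gt0 : 0 < n%:R - 1 :> R.
Proof. by rewrite subr_gt0 ltr1n. Qed.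

Lemma frame_bessel (l : 'cV[R]_n) :
  \sum_i (P *m l) i 0 ^+ 2 + (\sum_i l i 0) ^+ 2 / n%:R <= \sum_i l i 0 ^+ 2.
Proof.
have dotE m (v : 'cV[R]_m) : \sum_i v i 0 ^+ 2 = (v^T *m v) 0 0.
  by rewrite mxE; apply: eq_bigr => i _; rewrite mxE expr2.
pose e : 'cV[R]_n := const_mx 1.
have eTe : e^T *m e = n%:R%:M.
  apply/matrixP => i j; rewrite !ord1 !mxE/= mulr1n.
  rewrite (eq_bigr (fun=> 1)); last by move=> k _; rewrite !mxE mulr1.
  by rewrite sumr_const card_ord.
have sumE : \sum_i l i 0 = (e^T *m l) 0 0.
  by rewrite mxE; apply: eq_bigr => i _; rewrite !mxE mul1r.
pose Q := P^T *m P + n%:R^-1 *: (e *m e^T).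
have eTP : e^T *m P^T = 0 by rewrite -trmx_mul P1 trmx0.
have QT : Q^T = Q by rewrite /Q linearD linearZ/= !trmx_mul !trmxK.
have QQ : Q *m Q = Q.
  rewrite {1 2}/Q mulmxDl !mulmxDr -!scalemxAl -!scalemxAr.
  rewrite !mulmxA -(mulmxA P^T P P^T) PPt mulmx1.
  rewrite -(mulmxA P^T P e) P1 mulmx0 mul0mx scaler0 addr0.
  rewrite -(mulmxA e e^T P^T) eTP mulmx0 mul0mx scaler0 add0r.
  rewrite -(mulmxA e e^T e) eTe mul_mx_scalar -scalemxAl.
  rewrite [n%:R^-1 *: (n%:R *: _)]scalerA.
  by rewrite mulVf ?gt_eqF// scale1r.
have : 0 <= ((l - Q *m l)^T *m (l - Q *m l)) 0 0.
  by rewrite -dotE sumr_ge0// => i _; exact: sqr_ge0.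
rewrite [(l - _)^T]linearB/= trmx_mul QT mulmxBr !mulmxBl !mulmxA.
rewrite -(mulmxA l^T Q Q) QQ subrr subr0.
rewrite mxE [X in _ + X]mxE -dotE subr_ge0; apply: le_trans.
rewrite /Q mulmxDr mulmxDl mxE; rewrite lerD//.
  by rewrite dotE trmx_mul !mulmxA.
rewrite sumE -scalemxAr -scalemxAl [leRHS]mxE [leLHS]mulrC ler_pM2l ?invr_gt0//.
have -> : l^T *m (e *m e^T) *m l = (e^T *m l)^T *m (e^T *m l).
  by rewrite trmx_mul trmxK !mulmxA.
by rewrite [leRHS]mxE big_ord1 expr2 [_^T _ _]mxE.
Qed.

Lemma image_simplex_sub_disk :
  [set P *m l | l in simplex n] `<=` disk 0 (Num.sqrt ((n%:R - 1) / n%:R)).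
Proof.
move=> _ [l [l1 l0] <-]; rewrite /disk/= subr0 enorm_le ?sqrtr_ge0//.
rewrite sqr_sqrtr; last by rewrite divr_ge0// ltW.
rewrite mulrBl divff ?gt_eqF// lerBrDr.
have := frame_bessel l; rewrite l1 expr1n => /le_trans; apply; rewrite -l1.
apply: ler_sum => i _; rewrite expr2 -[leRHS]mulr1 ler_wpM2l//.
by rewrite -l1 (bigD1 i)//= lerDl sumr_ge0.
Qed.

(* With t = 1/(n-1), expanding 0 <= |t p_i + y|^2 gives p_i . y >= -1/n. *)
Lemma disk_sub_image_simplex :
  disk 0 (Num.sqrt (1 / (n%:R * (n%:R - 1)))) `<=` [set P *m l | l in simplex n].
Proof.
move=> y; rewrite /disk/= subr0 enorm_le ?sqrtr_ge0//.
rewrite sqr_sqrtr => [yr|]; last by rewrite divr_ge0// mulr_ge0// ltW.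
exists (P^T *m y + const_mx n%:R^-1); last first.
  rewrite mulmxDr mulmxA PPt mul1mx (_ : const_mx _ = n%:R^-1 *: const_mx 1).
    by rewrite -scalemxAr P1 scaler0 addr0.
  by apply/matrixP => i j; rewrite !mxE mulr1.
split.
  rewrite (eq_bigr (fun i => (P^T *m y) i 0 + n%:R^-1)); last first.
    by move=> i _; rewrite !mxE.
  rewrite big_split/= sumr_const card_ord -[X in _ + X]mulr_natr mulVf ?gt_eqF//.
  have -> : \sum_i (P^T *m y) i 0 =
            ((P *m const_mx 1 : 'cV_2)^T *m y) 0 0; last first.
    by rewrite P1 trmx0 mul0mx mxE add0r.
  rewrite trmx_mul -mulmxA mxE; apply: eq_bigr => i _.
  by rewrite !mxE mul1r.
move=> i; rewrite !mxE.
have simpl0 : simplex n (delta_mx i 0 : 'cV[R]_n).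
  split=> [|j]; last by rewrite mxE; case: (_ && _).
  rewrite (bigD1 i)//= mxE !eqxx big1 ?addr0// => j /negPf ji.
  by rewrite mxE ji.
have := image_simplex_sub_disk (ex_intro2 _ _ _ simpl0 erefl).
rewrite /disk/= subr0 enorm_le ?sqrtr_ge0// sqr_sqrtr -?colE; last first.
  by rewrite divr_ge0// ltW.
move: yr; rewrite !big_ord_recl !big_ord0 !addr0 !mxE.
set y0 := y _ _; set y1 := y _ _; set p0 := P _ _; set p1 := P _ _.
have ->: 1 / (n%:R * (n%:R - 1)) = (n%:R - 1)^-1 * n%:R^-1 :> R.
  by rewrite mul1r invfM mulrC.
have tn : (n%:R - 1)^-1 * (n%:R - 1) = 1 :> R by rewrite mulVf ?gt_eqF.
have t0 : 0 < (n%:R - 1)^-1 :> R by rewrite invr_gt0.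
set t := (n%:R - 1)^-1 in tn t0 *; set m := n%:R - 1 in tn *; set k := n%:R^-1.
move=> yr pr.
have tp : t ^+ 2 * (p0 ^+ 2 + p1 ^+ 2) <= t * k.
  have -> : t * k = t ^+ 2 * (m * k) by rewrite -[LHS]mulr1 -tn; ring.
  by rewrite ler_pM2l ?exprn_gt0.
rewrite -(pmulr_rge0 _ t0).
have := sqr_ge0 (t * p0 + y0); have := sqr_ge0 (t * p1 + y1).
lra.
Qed.

End Frame.

Section SVD.
Variables (R : realType) (n : nat).
Variables (B : 'M[R]_(2, n)) (U : 'M[R]_2) (s1 s2 : R) (V : 'M[R]_n).
Hypothesis hsvd : is_svd B U s1 s2 V.
Hypothesis hn : (2 <= n)%N.

Lemma ref_mx_orthonormal : ref_mx hn U V *m (ref_mx hn U V)^T = 1%:M.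
Proof.
case: hsvd => -[UtU UUt] [VtV _] _ _.
rewrite /ref_mx trmx_mul trmxK mulmxA -(mulmxA U).
rewrite (_ : _^T *m _ = 1%:M) ?mulmx1//.
apply/matrixP => i j.
have := congr1 (fun M : 'M_n => M (widen_ord hn i) (widen_ord hn j)) VtV.
rewrite !mxE -val_eqE/= => <-.
by apply: eq_bigr => k _; rewrite !mxE.
Qed.

Lemma svd_colsubE :
  B = U *m (diag_mx (\row_(j < 2) if j == 0 then s1 else s2) *m
            (colsub (widen_ord hn) V)^T).
Proof.
case: hsvd => _ _ _ ->; rewrite -mulmxA; congr (_ *m _).
apply/matrixP => j i; rewrite mul_diag_mx !mxE (bigD1 (widen_ord hn j))//=.
rewrite !mxE eqxx big1 ?addr0//.
by move=> k /negPf; rewrite -val_eqE/= !mxE eq_sym => ->; rewrite mul0r.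
Qed.

Lemma ref_mx_centered : s1 != 0 -> s2 != 0 -> B *m const_mx 1 = 0 :> 'cV_2 ->
  ref_mx hn U V *m const_mx 1 = 0 :> 'cV_2.
Proof.
move=> s1N0 s2N0; rewrite {1}svd_colsubE => B1.
case: hsvd => -[UtU _] _ _ _.
rewrite /ref_mx -mulmxA; set w := _^T *m _ in B1 *.
suff -> : w = 0 by rewrite mulmx0.
move: B1; rewrite -!mulmxA => /(congr1 (mulmx U^T)).
rewrite mulmxA UtU mul1mx mulmx0 mul_diag_mx => /matrixP w0.
apply/colP => i; have /eqP := w0 i 0; rewrite !mxE mulf_eq0.
by case: ifP => _; rewrite ?(negPf s1N0) ?(negPf s2N0)/= => /eqP.
Qed.

End SVD.

Lemma centered_mx_sum (R : realType) n (x : 'I_n -> 'cV[R]_2) :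
  (0 < n)%N -> centered_mx x *m const_mx 1 = 0 :> 'cV_2.
Proof.
move=> n0; apply/colP => i; rewrite !mxE.
rewrite (eq_bigr (fun j => x j i 0 - arith_center x i 0)); last first.
  by move=> j _; rewrite !mxE mulr1.
rewrite big_split/= sumr_const card_ord !mxE summxE -[X in _ + X]mulr_natl.
by rewrite mulrN mulrA divff ?mul1r ?subrr// pnatr_eq0 -lt0n.
Qed.

(* If s2 = 0, all the vertices lie on the line through the center directed by
   the first column of U. *)
Lemma non_degenerate_svd_gt0 (R : realType) n (x : 'I_n -> 'cV[R]_2)
    (U : 'M[R]_2) s1 s2 (V : 'M[R]_n) :
  (3 <= n)%N -> non_degenerate x -> is_svd (centered_mx x) U s1 s2 V -> 0 < s2.
Proof.
move=> hn hnd hsvd; have [[UtU _] _ /andP[s2_ge0 _] _] := hsvd.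
rewrite lt_neqAle s2_ge0 andbT; apply/eqP => s20.
have on_line i : line (arith_center x) (col 0 U) (x i).
  exists (s1 * V i (widen_ord (ltnW hn) 0)) => //.
  apply/colP => k.
  have := congr1 (fun M : 'M_(_, _) => M k i) (svd_colsubE hsvd (ltnW hn)).
  rewrite mul_diag_mx !mxE big_ord_recl big_ord1 !mxE/= -s20 mul0r mulr0 addr0.
  move=> /eqP; rewrite subr_eq => /eqP ->.
  by rewrite addrC [X in X + _ = _]mulrC.
have U0 : col 0 U != 0.
  apply/eqP => U0; have := congr1 (fun M : 'M_2 => M 0 0) UtU.
  rewrite !mxE eqxx big1; first by move/eqP; rewrite eq_sym oner_eq0.
  by move=> j _; have /colP/(_ j) := U0; rewrite !mxE => ->; rewrite mulr0.
case: n hn x hnd V hsvd on_line => [|[|[|n]]]// hn x hnd V hsvd on_line.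
apply: (hnd 0 1 2%:R) => //.
by exists (arith_center x), (col 0 U).
Qed.

Theorem proposition2p10 (R : realType) (n : nat) (hn : (3 <= n)%N)
    (T : set 'cV[R]_2) (x : 'I_n -> 'cV[R]_2)
    (hT : convex_ngon T x) (hnd : non_degenerate x)
    (U : 'M[R]_2) (s1 s2 : R) (V : 'M[R]_n)
    (hsvd : is_svd (centered_mx x) U s1 s2 V) :
  let K := ref_polygon (ltnW hn) U V in
  exists rin rout : R,
    [/\ is_inradius K rin,
        is_outradius K rout,
        Num.sqrt (1 / (n%:R * (n%:R - 1))) <= rin,
        rout <= Num.sqrt ((n%:R - 1) / n%:R)
      & 1 <= rout / rin <= n%:R - 1].
Proof.
set P := ref_mx (ltnW hn) U V; move=> K.
have s2_gt0 := non_degenerate_svd_gt0 hn hnd hsvd.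
have s1_gt0 : 0 < s1 by case: hsvd => _ _ /andP[_ /(lt_le_trans s2_gt0)].
have PPt : P *m P^T = 1%:M := ref_mx_orthonormal hsvd (ltnW hn).
have P1 : P *m const_mx 1 = 0 :> 'cV_2.
  apply: (ref_mx_centered hsvd); rewrite ?gt_eqF//.
  by apply: centered_mx_sum; exact: ltnW (ltnW hn).
have Kin : disk 0 (Num.sqrt (1 / (n%:R * (n%:R - 1)))) `<=` K :=
  disk_sub_image_simplex (ltnW hn) PPt P1.
have Kout : K `<=` disk 0 (Num.sqrt ((n%:R - 1) / n%:R)) :=
  image_simplex_sub_disk (ltnW hn) PPt P1.
have K0 : K !=set0 by exists 0; apply: Kin; apply: disk_center; exact: sqrtr_ge0.
have Kc : compact K by apply: image_simplex_compact; exact: ltnW (ltnW hn).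
have [rin rinP] := ex_inradius Kc K0 Kout.
have [rout routP] := ex_outradius K0 Kout.
have n_gt0 : 0 < n%:R :> R by rewrite ltr0n; exact: ltnW (ltnW hn).
have n1_gt0 : 0 < n%:R - 1 :> R by rewrite subr_gt0 ltr1n ltnW.
have rin_ge : Num.sqrt (1 / (n%:R * (n%:R - 1))) <= rin.
  by apply: rinP.2; split; [exact: sqrtr_ge0|exists 0].
have rout_le : rout <= Num.sqrt ((n%:R - 1) / n%:R).
  by apply: routP.2; split; [exact: sqrtr_ge0|exists 0].
have rin_gt0 : 0 < rin.
  by apply: lt_le_trans rin_ge; rewrite sqrtr_gt0 divr_gt0 ?mulr_gt0.
exists rin, rout; split => //; apply/andP; split.
  rewrite ler_pdivlMr// mul1r.
  have [[[rin_ge0 [c csub]] _] [[_ [c' csub']] _]] := (rinP, routP).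
  by apply: (@disk_subset_le _ c c') => // y /csub/csub'.
rewrite ler_pdivrMr//; apply: le_trans rout_le _.
have -> : (n%:R - 1) / n%:R = (n%:R - 1) ^+ 2 * (1 / (n%:R * (n%:R - 1))) :> R.
  by field; rewrite !gt_eqF.
by rewrite sqrtrM ?sqr_ge0// sqrtr_sqr gtr0_norm// ler_pM2l.
Qed.
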